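(* For any parabolic subgroup $P\supseteq B$ and $w\in W^P$ we have $$\check R^+_{w,P}=\{\check\eta\in\check R^+(w)\mid \check\eta\text{ is indecomposable in }\check R^+(w)\text{ and } s_{\check\eta}(\check\alpha_j)\notin\check R^+(w)\text{ whenever } j\in I_P\}.$$
   Context: $G$ is a simply-connected simple complex algebraic group (arbitrary Lie type) with Borel subgroup $B$ and parabolic $P\supseteq B$. $W$ is the Weyl group with simple reflections $s_i$ ($i\in I$) and length function $\ell$; $\check\alpha_i$ are the simple coroots and $\check R^+$ the positive coroots. For a coroot $\check\eta$ with corresponding root $\eta$, $s_{\check\eta}$ is the reflection acting on coroots by $s_{\check\eta}(x)=x-\langle\eta,x\rangle\check\eta$. $I_P\subseteq I$ is the set of $i$ with $s_i$ represented in $P$, $W_P=\langle s_i\mid i\in I_P\rangle$, and $W^P$ is the set of minimal-length representatives of $W/W_P$. For $w\in W^P$: $\check R^+(w)=\{\check\alpha\in\check R^+\mid w(\check\alpha)<0\}$ and $\check R^+_{w,P}=\{\check\eta\in\check R^+(w)\mid\ell(ws_{\check\eta})=\ell(w)-1,\ ws_{\check\eta}\in W^P\}$. An element $\check\eta\in\check R^+(w)$ is decomposable in $\check R^+(w)$ if $\check\eta=\frac1c(\check\mu+\check\mu')$ for two distinct $\check\mu,\check\mu'\in\check R^+(w)$ and some $c\in\mathbb Z_{>0}$, and indecomposable otherwise. *)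

(* Defs.v *)
From HB Require Import structures.
From mathcomp Require Import all_boot all_algebra.
From mathcomp Require Import boolp classical_sets.
Set Implicit Arguments.
Unset Strict Implicit.
Unset Printing Implicit Defensive.
Import GRing.Theory.
Local Open Scope ring_scope.
Local Open Scope classical_set_scope.

(* Characters are row vectors and cocharacters column vectors. *)
Definition pairing (n : nat) (u : 'rV[int]_n) (x : 'cV[int]_n) : int :=
  (u *m x) 0 0.

(* Root datum with X^* = Z^n and X_* = Z^n, in perfect duality by [pairing].
   [root] is the bijection from coroots to roots; its values outside
   [coroots] carry no meaning, and the set of roots is [map root coroots]. *)
Record rootDatum (n : nat) := RootDatum {
  coroots : seq 'cV[int]_n;
  root : 'cV[int]_n -> 'rV[int]_n;
  root_inj : {in coroots &, injective root};
  root_coroot2 : {in coroots, forall x, pairing (root x) x = 2};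
  reflect_coroots : {in coroots &, forall x y,
    y - pairing (root x) y *: x \in coroots};
  reflect_roots : {in coroots &, forall x y,
    root y - pairing (root y) x *: root x \in map root coroots}
}.

Section RootDatum.
Variables (n : nat) (D : rootDatum n).

(* Proportionality over the rationals, with denominators cleared. *)
Definition reduced : Prop :=
  forall x y (a b : int), x \in coroots D -> y \in coroots D -> b != 0 ->
    a *: root D x = b *: root D y ->
    root D y = root D x \/ root D y = - root D x.

Definition irreducible : Prop :=
  coroots D <> [::] /\
  forall A : {pred 'cV[int]_n},
    {in coroots D &, forall x y, x \in A -> y \notin A ->
      pairing (root D x) y = 0 /\ pairing (root D y) x = 0} ->
    {subset coroots D <= A} \/ {in coroots D, forall x, x \notin A}.

(* The cocharacter lattice is the coroot lattice; in particular the datum is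
   semisimple. *)
Definition simply_connected : Prop :=
  forall x : 'cV[int]_n, exists c : 'cV[int]_n -> int,
    x = \sum_(y <- coroots D) c y *: y.

(* The matrix of x |-> x - <eta, x> eta^vee. *)
Definition reflection (eta : 'cV[int]_n) : 'M[int]_n :=
  1%:M - eta *m root D eta.

Variables (I : finType) (alpha : I -> 'cV[int]_n).

(* The coroots [alpha i] are the simple coroots: their roots form a base of
   the root system. *)
Definition is_base : Prop :=
  [/\ forall i, alpha i \in coroots D,
      forall c : I -> int, \sum_i c i *: root D (alpha i) = 0 ->
        forall i, c i = 0
    & forall x, x \in coroots D -> exists c : I -> nat,
        root D x = \sum_i root D (alpha i) *+ c i \/
        root D x = - \sum_i root D (alpha i) *+ c i].

(* Coroots of positive roots. *)
Definition pos_coroots : set 'cV[int]_n :=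
  [set x | x \in coroots D /\
    exists c : I -> nat, root D x = \sum_i root D (alpha i) *+ c i].

Definition word_prod (t : seq I) : 'M[int]_n :=
  \big[mulmx/1%:M]_(i <- t) reflection (alpha i).

Definition weyl : set 'M[int]_n := range word_prod.

Definition weyl_parabolic (J : {set I}) : set 'M[int]_n :=
  [set u | exists2 t : seq I, {subset t <= J} & u = word_prod t].

(* Equal to 0 outside the Weyl group. *)
Definition length (w : 'M[int]_n) : nat :=
  if pselect (exists k, [exists t : k.-tuple I, w == word_prod t]) is left h
  then ex_minn h else 0%N.

Definition min_reps (J : {set I}) : set 'M[int]_n :=
  [set w | weyl w /\
    forall u, weyl_parabolic J u -> (length w <= length (w *m u))%N].

Definition inversions (w : 'M[int]_n) : set 'cV[int]_n :=
  [set x | pos_coroots x /\ pos_coroots (- (w *m x))].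

Definition covers (w : 'M[int]_n) (J : {set I}) : set 'cV[int]_n :=
  [set eta | [/\ inversions w eta,
    (length (w *m reflection eta)).+1 = length w
    & min_reps J (w *m reflection eta)]].

End RootDatum.

(* eta = (mu + mu') / c, with the denominator cleared. *)
Definition decomposable (n : nat) (S : set 'cV[int]_n) (eta : 'cV[int]_n) :
    Prop :=
  exists mu mu' : 'cV[int]_n, exists c : nat,
    [/\ S mu, S mu', mu <> mu', (0 < c)%N & eta *+ c = mu + mu'].

(* Main.v *)
Require Import Defs.
From HB Require Import structures.
From mathcomp Require Import all_boot all_order all_algebra.
From mathcomp Require Import boolp classical_sets.
From mathcomp Require Import zify ring.
Set Implicit Arguments.
Unset Strict Implicit.
Unset Printing Implicit Defensive.
Import GRing.Theory.
Import Order.TTheory Num.Theory.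
Import Defs.
Local Open Scope ring_scope.
Local Open Scope classical_set_scope.

(** Let [w] lie in the Weyl group and let [eta] be an inversion of [w], that is,
    a positive coroot with [w eta < 0]. Put [s = s_eta] and consider the set of
    positive coroots [x] with [s x < 0]. It carries the involution
    [x |-> - s x], and [x + (- s x) = k eta] with [k > 0], so applying [w] shows
    that at least one of [x], [- s x] is an inversion of [w]. Comparing the
    inversions of [w] and of [w s] through this involution gives
<<
    l(w) = l(w s) + #{x | x and - s x are both inversions of w}
>>
    ([ninv_mirrored]). The set on the right contains [eta], so
    [l(w s) = l(w) - 1] exactly when it contains nothing else ([length_cover]).

    An element [x <> eta] of that set exhibits [eta] as decomposable.
    Conversely, let [c eta = mu + mu'] with [mu <> mu'] inversions of [w], named
    so that [k = <eta, mu>] is at least [<eta, mu'>]. Then [k >= c], because the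
    two pairings add up to [2 c], and [- s mu = (k - c) eta + mu'] is a
    nonnegative combination of inversions: it is positive and [w] makes it
    negative. So [mu] belongs to the set, and [mu <> eta] since otherwise [mu']
    would be proportional to [eta] ([decomposable_mirrored]).

    For the parabolic condition, [u] is a minimal representative for [J] exactly
    when [u alpha_j > 0] for all [j] in [J] ([min_repsP]). If [w] is minimal and
    [w s alpha_j < 0], then [s alpha_j] is positive, hence an inversion of [w]:
    otherwise [k eta - alpha_j] would be a positive coroot with [k > 0], and so
    [w (k eta)] would be the sum of the positive [w alpha_j] and of
    [w (k eta - alpha_j) = - w s alpha_j], which is positive too, against
    [w eta < 0] ([min_reps_reflection]).

    Two general facts support this. First, signs of coroots are read off a
    linear function, the pairing [ht] with the sum of the positive roots; since
    the sign of a coroot is by definition that of its root, relations between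
    roots are carried to coroots by the invariant form [coform]. Second, the
    word length equals the number of inversions ([length_word]), a consequence of
    the strong exchange property ([strong_exchange]), which also shows that
    [w s_eta] lies in the Weyl group. *)

(** * The pairing of characters and cocharacters *)

Section Pairing.
Variable n : nat.
Implicit Types (u v : 'rV[int]_n) (x y : 'cV[int]_n).

Lemma pairingDr u x y : pairing u (x + y) = pairing u x + pairing u y.
Proof. by rewrite /pairing mulmxDr mxE. Qed.

Lemma pairingNr u x : pairing u (- x) = - pairing u x.
Proof. by rewrite /pairing mulmxN mxE. Qed.

Lemma pairingBr u x y : pairing u (x - y) = pairing u x - pairing u y.
Proof. by rewrite pairingDr pairingNr. Qed.

Lemma pairingZr u a x : pairing u (a *: x) = a * pairing u x.
Proof. by rewrite /pairing -scalemxAr mxE. Qed.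

Lemma pairing0r u : pairing u 0 = 0.
Proof. by rewrite /pairing mulmx0 mxE. Qed.

Lemma pairing_sumr u (T : Type) (s : seq T) (F : T -> 'cV_n) :
  pairing u (\sum_(i <- s) F i) = \sum_(i <- s) pairing u (F i).
Proof. by rewrite /pairing mulmx_sumr summxE. Qed.

Lemma pairingDl u v x : pairing (u + v) x = pairing u x + pairing v x.
Proof. by rewrite /pairing mulmxDl mxE. Qed.

Lemma pairingNl u x : pairing (- u) x = - pairing u x.
Proof. by rewrite /pairing mulNmx mxE. Qed.

Lemma pairingZl a u x : pairing (a *: u) x = a * pairing u x.
Proof. by rewrite /pairing -scalemxAl mxE. Qed.

Lemma pairing_suml (T : Type) (s : seq T) (F : T -> 'rV_n) x :
  pairing (\sum_(i <- s) F i) x = \sum_(i <- s) pairing (F i) x.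
Proof. by rewrite /pairing mulmx_suml summxE. Qed.

Lemma pairing_mulmx u (A : 'M_n) x : pairing u (A *m x) = pairing (u *m A) x.
Proof. by rewrite /pairing mulmxA. Qed.

Lemma pairing_nondegenerate u : (forall x, pairing u x = 0) -> u = 0.
Proof.
move=> u0; apply/rowP=> i; move: (u0 (delta_mx i 0)).
by rewrite /pairing -colE !mxE.
Qed.

Lemma intmx_scalerI m k (a : int) (A B : 'M[int]_(m, k)) :
  a != 0 -> a *: A = a *: B -> A = B.
Proof.
move=> a0 /matrixP AB; apply/matrixP=> i j.
by move: (AB i j); rewrite !mxE => /(mulfI a0).
Qed.

End Pairing.

(** * Reflections and the invariant form *)

Section Coroots.
Variables (n : nat) (D : rootDatum n).
Implicit Types (u v : 'rV[int]_n) (x y z : 'cV[int]_n).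

Definition corootset := undup (coroots D).

Lemma mem_corootset x : (x \in corootset) = (x \in coroots D).
Proof. by rewrite mem_undup. Qed.

Lemma reflectionE x y :
  reflection D x *m y = y - pairing (root D x) y *: x.
Proof.
rewrite mulmxBl mul1mx -mulmxA [root D x *m y]mx11_scalar.
by rewrite mul_mx_scalar.
Qed.

Lemma mul_reflection u x :
  u *m reflection D x = u - pairing u x *: root D x.
Proof.
rewrite mulmxBr mulmx1 mulmxA [u *m x]mx11_scalar.
by rewrite mul_scalar_mx.
Qed.

Lemma reflection_coroot x y : x \in coroots D -> y \in coroots D ->
  reflection D x *m y \in coroots D.
Proof. by move=> xD yD; rewrite reflectionE; apply: reflect_coroots. Qed.

Lemma reflection_self x : x \in coroots D -> reflection D x *m x = - x.
Proof.
move=> xD; rewrite reflectionE root_coroot2 //.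
by apply/matrixP=> i j; rewrite !mxE; ring.
Qed.

Lemma root_reflection_self x :
  x \in coroots D -> root D x *m reflection D x = - root D x.
Proof.
move=> xD; rewrite mul_reflection root_coroot2 //.
by apply/matrixP=> i j; rewrite !mxE; ring.
Qed.

Lemma reflection_invol x :
  x \in coroots D -> reflection D x *m reflection D x = 1%:M.
Proof.
move=> xD; rewrite {2}/reflection mulmxBr mulmx1 mulmxA reflection_self //.
by rewrite mulNmx /reflection opprK subrK.
Qed.

Lemma coroot_opp x : x \in coroots D -> - x \in coroots D.
Proof. by move=> xD; rewrite -reflection_self // reflection_coroot. Qed.

Lemma perm_map_stable (A B : 'M[int]_n) (s : seq 'cV[int]_n) :
  uniq s -> B *m A = 1%:M -> {in s, forall x, A *m x \in s} ->
  perm_eq [seq A *m x | x <- s] s.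
Proof.
move=> Us BA As.
have Ainj : injective (fun x : 'cV_n => A *m x).
  by move=> x y /(congr1 (mulmx B)); rewrite !mulmxA BA !mul1mx.
have Uma : uniq [seq A *m x | x <- s] by rewrite map_inj_uniq.
have sub : {subset [seq A *m x | x <- s] <= s}.
  by move=> _ /mapP[x + ->] => /As.
apply: uniq_perm => //.
by case: (uniq_min_size Uma sub) => //; rewrite size_map.
Qed.

(** Sums and counts over all coroots are reindexed along this permutation; it is
    available because [corootset] has no duplicates, whereas multiplicities in
    [coroots D] need not be preserved by [A]. *)
Lemma perm_corootset (A B : 'M[int]_n) : B *m A = 1%:M ->
  (forall x, x \in coroots D -> A *m x \in coroots D) ->
  perm_eq [seq A *m x | x <- corootset] corootset.
Proof.
move=> BA AD; apply: perm_map_stable BA _ => [|x]; first exact: undup_uniq.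
by rewrite !mem_corootset => /AD.
Qed.

Lemma perm_reflection x : x \in coroots D ->
  perm_eq [seq reflection D x *m y | y <- corootset] corootset.
Proof.
move=> xD; apply: (perm_corootset (reflection_invol xD)) => y.
exact: reflection_coroot.
Qed.

(** The map from characters to cocharacters given by the Weyl-invariant form
    [(u, v) = sum of <u, x> <v, x>] over the coroots [x]. It carries each root to
    a positive multiple of its coroot ([coform_root]), and so translates linear
    relations between roots into relations between coroots. *)
Definition coform u : 'cV[int]_n := \sum_(x <- corootset) pairing u x *: x.

Definition sqnorm u : int := pairing u (coform u).

Lemma coformZ a u : coform (a *: u) = a *: coform u.
Proof.
rewrite scaler_sumr; apply: eq_bigr => x _.
by rewrite pairingZl scalerA.
Qed.

Lemma coformN u : coform (- u) = - coform u.
Proof. by rewrite -scaleN1r coformZ scaleN1r. Qed.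

Lemma coformD u v : coform (u + v) = coform u + coform v.
Proof.
rewrite -big_split; apply: eq_bigr => x _.
by rewrite pairingDl scalerDl.
Qed.

Lemma coformMn u k : coform (u *+ k) = coform u *+ k.
Proof. by rewrite -!scaler_nat coformZ. Qed.

Lemma coform_sum (T : Type) (s : seq T) (F : T -> 'rV_n) :
  coform (\sum_(i <- s) F i) = \sum_(i <- s) coform (F i).
Proof.
elim/big_rec2: _ => [|i x y _ IH]; last by rewrite coformD IH.
by rewrite -[0 in LHS](scale0r 0) coformZ scale0r.
Qed.

Lemma coform_reflection x u : x \in coroots D ->
  coform (u *m reflection D x) = reflection D x *m coform u.
Proof.
move=> xD; rewrite /coform mulmx_sumr -[LHS](perm_big _ (perm_reflection xD)).
rewrite big_map; apply: eq_bigr => y _.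
by rewrite pairing_mulmx -mulmxA reflection_invol // mulmx1 -scalemxAr.
Qed.

Lemma sqnorm_reflection x u : x \in coroots D ->
  sqnorm (u *m reflection D x) = sqnorm u.
Proof.
move=> xD; rewrite /sqnorm coform_reflection // pairing_mulmx -mulmxA.
by rewrite reflection_invol // mulmx1.
Qed.

Lemma sqnormE u : sqnorm u = \sum_(x <- corootset) pairing u x ^+ 2.
Proof. by rewrite /sqnorm pairing_sumr; apply: eq_bigr=> x _; rewrite pairingZr. Qed.

Lemma sqnorm_gt0 x : x \in coroots D -> 0 < sqnorm (root D x).
Proof.
move=> xD; rewrite sqnormE (big_rem x) ?mem_corootset //= root_coroot2 //.
by apply: ltr_wpDr => //; apply: sumr_ge0 => y _; apply: sqr_ge0.
Qed.

(** By invariance, [coform (root x)] is negated by [s_x]; the formula for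
    [s_x] then determines it. *)
Lemma coform_root x : x \in coroots D ->
  coform (root D x) *+ 2 = sqnorm (root D x) *: x.
Proof.
move=> xD; have := coform_reflection (root D x) xD.
rewrite root_reflection_self // coformN reflectionE.
move=> /eqP; rewrite -subr_eq0 => /eqP E.
apply/subr0_eq; rewrite -[RHS]oppr0 -E /sqnorm mulr2n.
by apply/matrixP=> i j; rewrite !mxE; ring.
Qed.

(** The datum only provides that [s_x (root y)] is the root of some coroot [z];
    by [coform_root], [z] and [s_x y] have the same image under the form, up to
    the norm, which [s_x] preserves. *)
Lemma root_reflection x y : x \in coroots D -> y \in coroots D ->
  root D (reflection D x *m y) = root D y *m reflection D x.
Proof.
move=> xD yD.
have /mapP[z zD Ez] : root D y *m reflection D x \in map (root D) (coroots D).
  by rewrite mul_reflection; apply: reflect_roots.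
rewrite Ez; congr root; apply/esym.
have nz : sqnorm (root D z) != 0 by rewrite gt_eqF // sqnorm_gt0.
apply: (intmx_scalerI nz); rewrite -coform_root // -Ez.
rewrite coform_reflection // sqnorm_reflection // -scaler_nat scalemxAr.
by rewrite scaler_nat coform_root // scalemxAr.
Qed.

Lemma root_opp x : x \in coroots D -> root D (- x) = - root D x.
Proof.
by move=> xD; rewrite -reflection_self // root_reflection // root_reflection_self.
Qed.

Lemma reflection_conj x y : x \in coroots D -> y \in coroots D ->
  reflection D x *m reflection D y =
  reflection D (reflection D x *m y) *m reflection D x.
Proof.
move=> xD yD; rewrite [reflection D (_ *m y)]/reflection root_reflection //.
rewrite [reflection D y]/reflection.
have ss := reflection_invol xD; move: (reflection D x) ss => s ss.
by rewrite mulmxBl mul1mx -!mulmxA ss mulmx1 mulmxBr mulmx1.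
Qed.

(** If [coform u = 0] then the sum of the squares [<u, x>^2] vanishes, so [u] is
    orthogonal to the coroots, which span the cocharacter lattice. *)
Lemma coform_inj : simply_connected D -> injective coform.
Proof.
move=> sc u v /eqP; rewrite -subr_eq0 -coformN -coformD => /eqP uv.
apply/subr0_eq/pairing_nondegenerate => x.
have [c ->] := sc x; rewrite pairing_sumr big1_seq // => y /= yD.
rewrite pairingZr; apply/eqP; rewrite mulf_eq0 -[X in _ || X]sqrf_eq0.
apply/orP; right; rewrite eq_le sqr_ge0 andbT.
have := congr1 (pairing (u - v)) uv; rewrite pairing0r -/(sqnorm _) sqnormE.
rewrite (big_rem y) ?mem_corootset //= => E.
by rewrite -[X in _ <= X]E lerDl sumr_ge0 // => z _; apply: sqr_ge0.
Qed.

(** Reducedness speaks of roots; injectivity of [coform] turns proportional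
    coroots into proportional roots. *)
Lemma proportional_coroots x y (a b : int) :
  simply_connected D -> reduced D -> x \in coroots D -> y \in coroots D ->
  0 < a -> 0 < b -> a *: x = b *: y -> x = y.
Proof.
move=> sc red xD yD a0 b0 Exy.
have Nx := sqnorm_gt0 xD; have Ny := sqnorm_gt0 yD.
have : (a * sqnorm (root D y)) *: root D x = (b * sqnorm (root D x)) *: root D y.
  have n2 : (2%:R : int) != 0 by [].
  apply/coform_inj/(intmx_scalerI n2) => //.
  (* The factor 2 is the one in [coform_root]. *)
  have E2 z c : z \in coroots D ->
      2%:R *: (c *: coform (root D z)) = (c * sqnorm (root D z)) *: z.
    by move=> zD; rewrite scalerA [_ * c]mulrC -!scalerA scaler_nat coform_root.
  rewrite !coformZ !E2 //.
  rewrite (_ : a * _ * _ = sqnorm (root D y) * sqnorm (root D x) * a); last ring.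
  rewrite (_ : b * _ * _ = sqnorm (root D y) * sqnorm (root D x) * b); last ring.
  by rewrite -scalerA Exy scalerA.
have b'0 : b * sqnorm (root D x) != 0 by rewrite gt_eqF // mulr_gt0.
case/(red _ _ _ _ xD yD b'0) => [|E].
  by move/root_inj => /(_ yD xD).
have Eyx : y = - x by apply: (root_inj yD); rewrite ?coroot_opp // root_opp.
have := congr1 (pairing (root D x)) Exy.
rewrite Eyx !pairingZr pairingNr root_coroot2 //; nia.
Qed.

End Coroots.

(** * Positive coroots and the height function *)

Section Base.
Variables (n : nat) (D : rootDatum n) (I : finType) (alpha : I -> 'cV[int]_n).
Hypotheses (D_reduced : reduced D) (alpha_base : is_base D alpha).
Implicit Types (x y z : 'cV[int]_n) (i j : I) (J : {set I}).

Lemma simple_coroot i : alpha i \in coroots D.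
Proof. by case: alpha_base. Qed.

Lemma base_coef_inj (c d : I -> int) :
  \sum_i c i *: root D (alpha i) = \sum_i d i *: root D (alpha i) -> c =1 d.
Proof.
case: alpha_base => _ free _ cd i; apply/subr0_eq.
apply: (free (fun i => c i - d i)).
under eq_bigr do rewrite scalerBl.
by rewrite sumrB cd subrr.
Qed.

Lemma sum_natcoef (c : I -> nat) :
  \sum_i root D (alpha i) *+ c i = \sum_i (c i)%:Z *: root D (alpha i).
Proof. by apply: eq_bigr => i _; rewrite -scaler_nat natz. Qed.

Lemma coroot_sign x : x \in coroots D ->
  pos_coroots D alpha x \/ pos_coroots D alpha (- x).
Proof.
case: alpha_base => _ _ dich xD; case: (dich x xD) => c [] E.
  by left; split=> //; exists c.
by right; split; [exact: coroot_opp|exists c; rewrite root_opp // E opprK].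
Qed.

Lemma coef_exists x (c : I -> nat) : x \in coroots D ->
  root D x = \sum_i root D (alpha i) *+ c i -> exists i, (0 < c i)%N.
Proof.
move=> xD E; apply: contrapT => nc.
have : root D x = 0.
  rewrite E big1 // => i _; case E' : (c i) => [|k] //.
  by case: nc; exists i; rewrite E'.
by move=> r0; move: (root_coroot2 xD); rewrite r0 /pairing mul0mx mxE.
Qed.

Lemma pos_coroot_opp x : pos_coroots D alpha x -> ~ pos_coroots D alpha (- x).
Proof.
move=> [xD [c Ec]] [_ [d Ed]]; have [i ci] := coef_exists xD Ec.
have := @base_coef_inj (fun i => (c i)%:Z) (fun i => - (d i)%:Z).
rewrite -sum_natcoef -Ec.
under [X in _ = X -> _]eq_bigr do rewrite scaleNr.
rewrite sumrN -sum_natcoef -Ed root_opp // opprK => /(_ erefl i); lia.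
Qed.

(** The positive coroots whose root is not a combination of the simple roots in
    [J]. The group generated by the reflections in [J] permutes them, since it
    leaves the coefficients outside [J] unchanged. The case of a singleton [J]
    says that [s_i] permutes the positive coroots other than [alpha i]. *)
Definition root_support_exceeds J x :=
  x \in coroots D /\ exists c : I -> nat,
    root D x = \sum_i root D (alpha i) *+ c i /\
    exists2 i, i \notin J & (0 < c i)%N.

Lemma root_support_exceeds_pos J x :
  root_support_exceeds J x -> pos_coroots D alpha x.
Proof. by case=> xD [c [E _]]; split=> //; exists c. Qed.

Lemma root_support_exceeds_reflection J j x : j \in J ->
  root_support_exceeds J x ->
  root_support_exceeds J (reflection D (alpha j) *m x).
Proof.
move=> jJ [xD [c [Ec [i iJ ci]]]].
have aD := simple_coroot j; have sD := reflection_coroot aD xD.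
split=> //; have := root_reflection aD xD.
set m := pairing (root D x) (alpha j); rewrite mul_reflection -/m => Es.
have {}Es : root D (reflection D (alpha j) *m x) =
    \sum_k ((c k)%:Z - (k == j)%:Z * m) *: root D (alpha k).
  rewrite Es Ec sum_natcoef; under [RHS]eq_bigr do rewrite scalerBl.
  rewrite sumrB (bigD1 j) //= [X in _ = _ - X](bigD1 j) //= eqxx mul1r.
  rewrite [X in _ = _ - (_ + X)]big1 ?addr0 // => k /negPf ->.
  by rewrite mul0r scale0r.
have nij : (i == j) = false by apply/negP => /eqP ij; rewrite ij jJ in iJ.
case: alpha_base => _ _ /(_ _ sD)[d [Ed|Ed]].
  exists d; split=> //; exists i => //.
  by move: Es; rewrite Ed sum_natcoef => /base_coef_inj/(_ i); rewrite nij; lia.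
exfalso; move: Es; rewrite Ed sum_natcoef -sumrN.
under [X in X = _ -> _]eq_bigr do rewrite -scaleNr.
by move/base_coef_inj/(_ i); rewrite nij; lia.
Qed.

Lemma pos_coroot_support i x : pos_coroots D alpha x -> x <> alpha i ->
  root_support_exceeds [set i]%SET x.
Proof.
move=> [xD [c Ec]] xi; split=> //; exists c; split=> //.
apply: contrapT => nc.
have Ex : root D x = root D (alpha i) *+ c i.
  rewrite Ec (bigD1 i) //= big1 ?addr0 // => j ji.
  case E : (c j) => [|k] //; case: nc; exists j; last by rewrite E.
  by rewrite inE.
have ci : (c i)%:Z != 0.
  apply/eqP => -[c0]; move: (root_coroot2 xD).
  by rewrite Ex c0 /pairing mul0mx mxE.
have E1 : 1 *: root D x = (c i)%:Z *: root D (alpha i).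
  by rewrite scale1r Ex -scaler_nat natz.
case: (D_reduced xD (simple_coroot i) ci E1) => [/root_inj|] E.
  by apply/xi/esym/E => //; exact: simple_coroot.
have := root_coroot2 xD; rewrite Ex E -scaler_nat pairingZl pairingNl.
by rewrite root_coroot2 // natz; lia.
Qed.

Lemma simple_reflection_pos i x : pos_coroots D alpha x -> x <> alpha i ->
  pos_coroots D alpha (reflection D (alpha i) *m x).
Proof.
move=> xp xi; apply: (@root_support_exceeds_pos [set i]%SET).
apply: root_support_exceeds_reflection; first by rewrite inE.
exact: pos_coroot_support.
Qed.

Definition posseq := [seq x <- corootset D | `[< pos_coroots D alpha x >]].

Lemma mem_posseq x : reflect (pos_coroots D alpha x) (x \in posseq).
Proof.
rewrite mem_filter mem_corootset; apply: (iffP andP) => [[/asboolP]//|xp].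
by split; [exact/asboolP|case: xp].
Qed.

Lemma simple_coroot_pos i : pos_coroots D alpha (alpha i).
Proof.
split; first exact: simple_coroot.
exists (fun j => (j == i) : nat); rewrite (bigD1 i) //= eqxx big1 ?addr0 //.
by move=> j /negPf ->.
Qed.

(** Pairing with the sum of the positive roots, usually written [2 rho]. *)
Definition ht x := pairing (\sum_(y <- posseq) root D y) x.

(** [s_i] permutes the positive coroots other than [alpha i] and changes the
    sign of the pairing of their roots with [alpha i], so these pairings sum to
    zero and only that of [alpha i] with its own root remains. *)
Lemma ht_simple i : ht (alpha i) = 2.
Proof.
have aP : alpha i \in posseq by apply/mem_posseq/simple_coroot_pos.
have uP : uniq posseq by rewrite filter_uniq // undup_uniq.
have aD := simple_coroot i.
rewrite /ht pairing_suml (big_rem _ aP) /= root_coroot2 //.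
set S := (X in _ + X); suff : S = - S by lia.
have perm : perm_eq [seq reflection D (alpha i) *m x | x <- rem (alpha i) posseq]
    (rem (alpha i) posseq).
  apply: (perm_map_stable _ (reflection_invol aD)) => [|x].
    exact: rem_uniq.
  rewrite !mem_rem_uniq // !inE => /andP[/eqP xi /mem_posseq xp].
  apply/andP; split; last exact/mem_posseq/simple_reflection_pos.
  apply/eqP => E; apply: (pos_coroot_opp (simple_coroot_pos i)).
  have := congr1 (mulmx (reflection D (alpha i))) E.
  by rewrite mulmxA reflection_invol // mul1mx reflection_self // => <-.
rewrite {1}/S -(perm_big _ perm) big_map -sumrN; apply: eq_big_seq => x.
move=> /mem_rem/mem_posseq[xD _].
by rewrite root_reflection // -pairing_mulmx reflection_self // pairingNr.
Qed.

(** The image under [coform] of the expansion of a positive root in simple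
    roots: a positive multiple of its coroot is a nonnegative combination of
    simple coroots. *)
Lemma coroot_simple_sum x (c : I -> nat) : x \in coroots D ->
  root D x = \sum_i root D (alpha i) *+ c i ->
  sqnorm D (root D x) *: x =
  \sum_i ((c i)%:Z * sqnorm D (root D (alpha i))) *: alpha i.
Proof.
move=> xD E; rewrite -coform_root // E coform_sum -sumrMnl.
apply: eq_bigr => i _; rewrite coformMn -mulrnAC coform_root ?simple_coroot //.
by rewrite -scaler_nat natz scalerA.
Qed.

Lemma ht_pos x : pos_coroots D alpha x -> 0 < ht x.
Proof.
move=> [xD [c E]]; have [i ci] := coef_exists xD E.
have N0 y (yD : y \in coroots D) := sqnorm_gt0 yD.
rewrite -(pmulr_rgt0 _ (N0 x xD)) -pairingZr (coroot_simple_sum xD E).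
rewrite pairing_sumr (bigD1 i) //= pairingZr -/(ht _) ht_simple.
apply: ltr_wpDr; last by rewrite !mulr_gt0 // N0 // simple_coroot.
apply: sumr_ge0 => j _; rewrite pairingZr -/(ht _) ht_simple.
by rewrite !mulr_ge0 // ltW // N0 // simple_coroot.
Qed.

Lemma htN x : ht (- x) = - ht x.
Proof. exact: pairingNr. Qed.

(** The sign of a coroot is that of a linear function, which makes the sign of a
    nonnegative combination of coroots computable. *)
Lemma pos_corootP x : x \in coroots D -> pos_coroots D alpha x <-> 0 < ht x.
Proof.
move=> xD; split=> [|h0]; first exact: ht_pos.
by case: (coroot_sign xD) => // /ht_pos; rewrite htN; lia.
Qed.

Lemma ht_neq0 x : x \in coroots D -> ht x != 0.
Proof. by move=> /coroot_sign[] /ht_pos; rewrite ?htN; lia. Qed.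

Lemma inversionP (w : 'M[int]_n) x :
  (forall y, y \in coroots D -> w *m y \in coroots D) ->
  inversions D alpha w x <-> [/\ x \in coroots D, 0 < ht x & ht (w *m x) < 0].
Proof.
move=> wD; split=> [[xp /ht_pos]|[xD xp wx]].
  by rewrite htN oppr_gt0; split=> //; [case: xp|exact: ht_pos].
split; first exact/pos_corootP.
by apply/pos_corootP; rewrite ?coroot_opp ?htN ?oppr_gt0 // wD.
Qed.


(** * Words, the exchange property and lengths *)

Local Notation W t := (word_prod D alpha t).

Lemma word_prod_cons i t : W (i :: t) = reflection D (alpha i) *m W t.
Proof. by rewrite /word_prod big_cons. Qed.

Lemma word_prod_cat t1 t2 : W (t1 ++ t2) = W t1 *m W t2.
Proof.
elim: t1 => [|i t IH]; first by rewrite /word_prod big_nil mul1mx.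
by rewrite cat_cons !word_prod_cons IH mulmxA.
Qed.

Lemma word_prod1 i : W [:: i] = reflection D (alpha i).
Proof. by rewrite word_prod_cons /word_prod big_nil mulmx1. Qed.

Lemma word_prod_rcons t i : W (rcons t i) = W t *m reflection D (alpha i).
Proof. by rewrite -cats1 word_prod_cat word_prod1. Qed.

Lemma word_prod_rev t : W (rev t) *m W t = 1%:M.
Proof.
elim: t => [|i t IH]; first by rewrite /word_prod big_nil mul1mx.
rewrite rev_cons word_prod_rcons word_prod_cons -mulmxA.
rewrite [reflection _ _ *m (_ *m _)]mulmxA.
by rewrite reflection_invol ?mul1mx // simple_coroot.
Qed.

Lemma word_prod_coroot t x : x \in coroots D -> W t *m x \in coroots D.
Proof.
elim: t => [|i t IH] xD; first by rewrite /word_prod big_nil mul1mx.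
rewrite word_prod_cons -mulmxA reflection_coroot ?IH //; exact: simple_coroot.
Qed.

Lemma word_prod_conj t x : x \in coroots D ->
  W t *m reflection D x = reflection D (W t *m x) *m W t.
Proof.
move=> xD; elim: t => [|i t IH].
  by rewrite /word_prod big_nil !mul1mx mulmx1.
rewrite word_prod_cons -mulmxA IH mulmxA reflection_conj ?mulmxA //.
  exact: simple_coroot.
exact: word_prod_coroot.
Qed.

(** Reading the word from the right, the image of [x] becomes negative at some
    letter [i]; at that moment it equals [alpha i], the only positive coroot that
    [s_i] makes negative. Conjugating, [s_x] cancels that letter. *)
Lemma strong_exchange t x : pos_coroots D alpha x -> ht (W t *m x) < 0 ->
  exists2 t', (size t').+1 = size t & W t *m reflection D x = W t'.
Proof.
move=> xp; have xD : x \in coroots D by case: xp.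
elim: t => [|i t IH].
  by rewrite /word_prod big_nil mul1mx; move: (ht_pos xp); lia.
have wxD := word_prod_coroot t xD; have aD := simple_coroot i.
rewrite word_prod_cons -!mulmxA.
case: (ltgtP (ht (W t *m x)) 0) => [wx _|wx swx|wx]; last first.
- by move: (ht_neq0 wxD); rewrite wx eqxx.
- have Ex : W t *m x = alpha i.
    apply: contrapT => xi.
    have := simple_reflection_pos ((pos_corootP wxD).2 wx) xi.
    by move/ht_pos; lia.
  exists t => //; rewrite word_prod_conj // Ex mulmxA.
  by rewrite reflection_invol // mul1mx.
- have [t' st' ->] := IH wx.
  by exists (i :: t'); rewrite /= ?st' // word_prod_cons.
Qed.

Definition ninv (w : 'M[int]_n) : nat :=
  count (fun x => (0 < ht x) && (ht (w *m x) < 0)) (corootset D).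

Lemma count_add (T : eqType) (p q r : pred T) (s : seq T) :
  {in s, forall a, p a = q a + r a :> nat}%N ->
  count p s = (count q s + count r s)%N.
Proof.
elim: s => //= a s IH pqr; rewrite pqr ?mem_head // IH; first by lia.
by move=> b bs; apply: pqr; rewrite inE bs orbT.
Qed.

Lemma count_mulmx (p : pred 'cV[int]_n) (A B : 'M[int]_n) : B *m A = 1%:M ->
  (forall x, x \in coroots D -> A *m x \in coroots D) ->
  count p (corootset D) = count (fun x => p (A *m x)) (corootset D).
Proof.
by move=> BA AD; rewrite -[LHS](permP (perm_corootset BA AD)) count_map.
Qed.

Lemma count_opp (p : pred 'cV[int]_n) :
  count p (corootset D) = count (fun x => p (- x)) (corootset D).
Proof.
have NN : - 1%:M *m - 1%:M = 1%:M :> 'M[int]_n.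
  by rewrite mulNmx mulmxN opprK mulmx1.
rewrite (count_mulmx _ NN).
  by apply: eq_count => x; rewrite mulNmx mul1mx.
by move=> x xD; rewrite mulNmx mul1mx coroot_opp.
Qed.

Definition reversed e x := (0 < ht x) && (ht (reflection D e *m x) < 0).

(** The inversions of [w s_e], moved by [s_e], are the coroots [x] with
    [s_e x > 0] and [w x < 0]. Those with [x > 0] are also inversions of [w];
    those with [x < 0] are the opposites of the positive coroots that [s_e]
    makes negative and [w] leaves positive. *)
Lemma ninv_reflection (w : 'M[int]_n) e : e \in coroots D ->
  (ninv w + count (fun x => reversed e x && (0 < ht (w *m x))%R) (corootset D) =
   ninv (w *m reflection D e)
   + count (fun x => reversed e x && (ht (w *m x) < 0)%R) (corootset D))%N.
Proof.
move=> eD; set s := reflection D e.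
have ss : s *m s = 1%:M := reflection_invol eD.
have sD x : x \in coroots D -> s *m x \in coroots D := reflection_coroot eD.
set common := count (fun x => [&& 0 < ht x, 0 < ht (s *m x) & ht (w *m x) < 0])
  (corootset D).
have E1 : ninv w = (common + count (fun x =>
    reversed e x && (ht (w *m x) < 0)%R) (corootset D))%N.
  apply: count_add => x; rewrite mem_corootset /reversed -/s => xD.
  by have := ht_neq0 (sD x xD); lia.
have E2 : ninv (w *m s) = (common + count (fun x =>
    reversed e x && (0 < ht (w *m x))%R) (corootset D))%N.
  rewrite /ninv (count_mulmx _ ss) // [X in (_ + X)%N]count_opp.
  apply: count_add => x; rewrite mem_corootset /reversed -/s => xD.
  rewrite !mulmxN !htN !mulmxA -[w *m s *m s]mulmxA ss mulmx1.
  rewrite !oppr_gt0 oppr_lt0; move: (ht_neq0 xD).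
  by case: (ltgtP (ht x)) => //= _ _; rewrite addn0.
rewrite E1 E2; lia.
Qed.

Lemma ninv1 : ninv 1%:M = 0%N.
Proof.
apply/eqP; rewrite -leqn0 leqNgt -has_count; apply/hasPn => x _.
by rewrite mul1mx; lia.
Qed.

(** Only [alpha i] is made negative by [s_i], so both corrections in
    [ninv_reflection] come from [alpha i] alone. *)
Lemma ninv_simple t i :
  ninv (W t *m reflection D (alpha i)) =
  if 0 < ht (W t *m alpha i) then (ninv (W t)).+1 else (ninv (W t)).-1.
Proof.
have aD := simple_coroot i; have := ninv_reflection (W t) aD.
have only (b : pred int) :
    count (fun x => reversed (alpha i) x && b (ht (W t *m x))) (corootset D) =
    b (ht (W t *m alpha i)).
  rewrite (@eq_in_count _ _ (fun x => (x == alpha i) && b (ht (W t *m alpha i)))).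
    case: b; last by rewrite (@eq_count _ _ pred0) ?count_pred0 // => x; rewrite andbF.
    rewrite (@eq_count _ _ (pred1 (alpha i))) => [|x]; last by rewrite andbT.
    by rewrite count_uniq_mem ?undup_uniq // mem_corootset aD.
  move=> x; rewrite mem_corootset /reversed => xD; case: eqVneq => [->|/eqP xi].
    by rewrite reflection_self // htN ht_simple.
  case hx : (0 < ht x) => //=.
  have /ht_pos := simple_reflection_pos ((pos_corootP xD).2 hx) xi; lia.
rewrite (only (fun k => 0 < k)) (only (fun k => k < 0)).
have := ht_neq0 (word_prod_coroot t aD); case: ifP; lia.
Qed.

Lemma ninv_le_size t : (ninv (W t) <= size t)%N.
Proof.
elim/last_ind: t => [|t i IH]; first by rewrite /word_prod big_nil ninv1.
by rewrite word_prod_rcons ninv_simple size_rcons; case: ifP; lia.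
Qed.

Lemma reduced_word t : exists2 t', size t' = ninv (W t) & W t = W t'.
Proof.
elim/last_ind: t => [|t i [t' st' Et']].
  by exists [::]; rewrite // /word_prod big_nil ninv1.
rewrite word_prod_rcons Et' ninv_simple; case: ifP => [ai|/negbT ai].
  by exists (rcons t' i); rewrite ?size_rcons ?word_prod_rcons // st' Et'.
have [|t'' st'' ->] := @strong_exchange t' _ (simple_coroot_pos i).
  by have := ht_neq0 (word_prod_coroot t' (simple_coroot i)); lia.
by exists t'' => //; rewrite -Et' -st' -st''.
Qed.

Lemma length_word t : length D alpha (W t) = ninv (W t).
Proof.
rewrite /length; case: pselect => [h|[]]; last first.
  by exists (size t); apply/existsP; exists (in_tuple t).
case: ex_minnP => m /existsP[t1 /eqP Et1] min; apply/eqP.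
rewrite eqn_leq {2}Et1 -{3}(size_tuple t1) ninv_le_size andbT.
have [t2 <- E2] := reduced_word t; apply: min.
by apply/existsP; exists (in_tuple t2); rewrite E2.
Qed.

(** When [w] keeps the simple coroots in [J] positive, no inversion of [w] has
    its root supported on [J]. For [u] in the parabolic subgroup, [u^-1]
    therefore keeps the inversions of [w] positive, and maps them injectively to
    inversions of [w u]. *)
Lemma min_repsP J t : min_reps D alpha J (W t) <->
  forall j, j \in J -> 0 < ht (W t *m alpha j).
Proof.
split=> [[_ min] j jJ|wJ].
  have aD := simple_coroot j; have := ht_neq0 (word_prod_coroot t aD).
  have := min (reflection D (alpha j)); rewrite -word_prod_rcons !length_word.
  rewrite word_prod_rcons ninv_simple; case: ifP => // /negbT wj le wn0.
  have /le : weyl_parabolic D alpha J (reflection D (alpha j)).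
    exists [:: j]; last by rewrite word_prod1.
    by move=> k; rewrite inE => /eqP ->.
  suff : (0 < ninv (W t))%N by lia.
  rewrite -has_count; apply/hasP; exists (alpha j).
    by rewrite mem_corootset.
  by rewrite ht_simple; lia.
split; first by exists t.
move=> _ [u uJ ->]; rewrite -word_prod_cat !length_word.
have uu := word_prod_rev (rev u); rewrite revK in uu.
rewrite {2}/ninv (count_mulmx _ uu) => [|x xD]; last exact: word_prod_coroot.
rewrite /ninv -!size_filter uniq_leq_size ?filter_uniq ?undup_uniq //.
move=> x; rewrite !mem_filter mem_corootset => /andP[/andP[xp wx] xD].
rewrite xD andbT word_prod_cat mulmxA -[W t *m _ *m _]mulmxA uu mulmx1 wx andbT.
suff : root_support_exceeds J (W (rev u) *m x).
  by move/root_support_exceeds_pos/ht_pos.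
have {}uJ : {subset rev u <= J} by move=> j; rewrite mem_rev => /uJ.
elim: (rev u) uJ => [|j v IH] vJ.
  rewrite /word_prod big_nil mul1mx; split=> //.
  have [_ [c Ec]] := (pos_corootP xD).2 xp; exists c; split=> //.
  apply: contrapT => nc; have := pmulr_rlt0 (ht (W t *m x)) (sqnorm_gt0 xD).
  rewrite wx -pairingZr scalemxAr (coroot_simple_sum xD Ec) mulmx_sumr.
  rewrite pairing_sumr ltNge => /negP[]; apply: sumr_ge0 => i _.
  rewrite -scalemxAr pairingZr -/(ht _).
  have [iJ|iJ] := boolP (i \in J).
    by rewrite !mulr_ge0 ?(ltW (wJ i iJ)) // ltW // sqnorm_gt0 // simple_coroot.
  case ci : (c i) => [|k]; first by rewrite !mul0r.
  by case: nc; exists i; rewrite ?ci.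
rewrite word_prod_cons -mulmxA; apply: root_support_exceeds_reflection.
  by rewrite vJ ?mem_head.
by apply: IH => k kv; rewrite vJ // inE kv orbT.
Qed.

(** * Covers and decomposable coroots *)

(** [x] and its mirror image [- s_e x] are both inversions of [W t]. *)
Definition mirrored t e x :=
  [&& reversed e x, ht (W t *m x) < 0 & 0 < ht (W t *m (reflection D e *m x))].

Lemma word_inversionP t x : inversions D alpha (W t) x <->
  [/\ x \in coroots D, 0 < ht x & ht (W t *m x) < 0].
Proof. exact/inversionP/word_prod_coroot. Qed.

Lemma ht_reflection (A : 'M[int]_n) e x :
  ht (A *m (reflection D e *m x)) =
  ht (A *m x) - pairing (root D e) x * ht (A *m e).
Proof. by rewrite reflectionE mulmxBr -scalemxAr /ht pairingBr pairingZr. Qed.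

Lemma reversed_pairing e x : 0 < ht e -> reversed e x ->
  0 < pairing (root D e) x.
Proof.
move=> he /andP[hx]; have := ht_reflection 1%:M e x; rewrite !mul1mx => ->.
nia.
Qed.

(** In [ninv_reflection], the involution [x |-> - s_e x] identifies the positive
    coroots that [s_e] makes negative and [w] keeps positive with the inversions
    whose mirror image is not an inversion. These cancel on both sides. *)
Lemma ninv_mirrored t e : inversions D alpha (W t) e ->
  ninv (W t) =
  (ninv (W t *m reflection D e) + count (mirrored t e) (corootset D))%N.
Proof.
move=> /word_inversionP[eD he we]; have := ninv_reflection (W t) eD.
set s := reflection D e; have ss : s *m s = 1%:M := reflection_invol eD.
have NN : (- s) *m (- s) = 1%:M by rewrite mulNmx mulmxN opprK.
set gain := count _ _; set loss := count _ (corootset D).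
have -> : gain = count (fun x => reversed e x && (ht (W t *m (s *m x)) < 0))
    (corootset D).
  rewrite /gain (count_mulmx _ NN); last first.
    by move=> x xD; rewrite mulNmx coroot_opp // reflection_coroot.
  apply: eq_count => x; rewrite /reversed -/s mulNmx !mulmxN !htN.
  by rewrite [s *m (s *m x)]mulmxA ss mul1mx !oppr_gt0 oppr_lt0 [X in X && _]andbC.
suff -> : loss = (count (fun x => reversed e x && (ht (W t *m (s *m x)) < 0)%R)
    (corootset D) + count (mirrored t e) (corootset D))%N by lia.
apply: count_add => x; rewrite mem_corootset /mirrored -/s => xD.
case rx : (reversed e x) => //=.
have := reversed_pairing he rx; have := ht_reflection (W t) e x; rewrite -/s.
have wsxD : W t *m (s *m x) \in coroots D.
  by apply/word_prod_coroot/reflection_coroot.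
have := ht_neq0 wsxD; set k := pairing _ _.
case: (ltgtP (ht (W t *m (s *m x))) 0) => //= wsx _ E k0; last by rewrite andbT.
suff -> : ht (W t *m x) < 0 by []; nia.
Qed.

Lemma mirrored_self t e : inversions D alpha (W t) e -> mirrored t e e.
Proof.
move=> /word_inversionP[eD he we].
by rewrite /mirrored /reversed reflection_self // mulmxN !htN oppr_gt0 oppr_lt0 he we.
Qed.

Lemma length_cover t e : inversions D alpha (W t) e ->
  (ninv (W t *m reflection D e)).+1 = ninv (W t) <->
  (forall x, x \in coroots D -> mirrored t e x -> x = e).
Proof.
move=> we; rewrite (ninv_mirrored we) -addn1; have ee := mirrored_self we.
have eD : e \in corootset D by rewrite mem_corootset; case/word_inversionP: we.
have U : uniq [seq x <- corootset D | mirrored t e x].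
  by rewrite filter_uniq // undup_uniq.
have ein : e \in [seq x <- corootset D | mirrored t e x].
  by rewrite mem_filter ee.
rewrite -size_filter; split=> [/addnI/esym sz x xD lx|only]; last first.
  congr (_ + _)%N; apply/eqP; rewrite eqn_leq; apply/andP; split.
    by case: (filter _ _) ein.
  apply: (@uniq_leq_size _ _ [:: e]) => // x.
  by rewrite mem_filter mem_corootset inE => /andP[lx xD]; apply/eqP/only.
have : x \in [seq x <- corootset D | mirrored t e x].
  by rewrite mem_filter lx mem_corootset.
case: (filter _ _) sz ein => [|a [|//]] //= _.
by rewrite !inE => /eqP-> /eqP.
Qed.

Hypothesis D_simply_connected : simply_connected D.

(** In the direct sense, the summand with the larger pairing with [e] is the
    mirrored one; in the converse sense, a mirrored coroot and its image add up
    to a positive multiple of [e]. *)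
Lemma decomposable_mirrored t e : inversions D alpha (W t) e ->
  decomposable (inversions D alpha (W t)) e <->
  exists2 x, x \in coroots D & mirrored t e x /\ x <> e.
Proof.
move=> /word_inversionP[eD he we]; split=> [[mu [nu [c [muI nuI munu c0 E]]]]|].
  (* The two pairings with [e] add up to [2 c], so the larger is at least [c]. *)
  wlog le : mu nu muI nuI munu E /
      pairing (root D e) nu <= pairing (root D e) mu => [th|].
    have [le|/ltW le] := lerP (pairing (root D e) nu) (pairing (root D e) mu).
      exact: (th mu nu).
    by apply: (th nu mu) => //; [exact: nesym|rewrite addrC].
  move: E; rewrite -scaler_nat natz => E.
  have kc : c%:Z <= pairing (root D e) mu.
    have := congr1 (pairing (root D e)) E.
    by rewrite pairingZr pairingDr root_coroot2 //; lia.
  have [muD hmu wmu] := (word_inversionP _ _).1 muI.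
  have [nuD hnu wnu] := (word_inversionP _ _).1 nuI.
  have hE : c%:Z * ht e = ht mu + ht nu.
    by have := congr1 ht E; rewrite /ht pairingZr pairingDr.
  have wE : c%:Z * ht (W t *m e) = ht (W t *m mu) + ht (W t *m nu).
    have := congr1 (fun x => ht (W t *m x)) E.
    by rewrite -scalemxAr mulmxDr /ht pairingZr pairingDr.
  exists mu => //; split.
    rewrite /mirrored /reversed hmu wmu /= ht_reflection.
    have := ht_reflection 1%:M e mu; rewrite !mul1mx => ->.
    by apply/andP; split; nia.
  move=> mue; apply: munu; rewrite mue.
  (* If [mu = e] then [nu] is a multiple of [e], hence equal to [e]. *)
  have Enu : (c%:Z - 1) *: e = nu by rewrite scalerBl scale1r E mue addrC addKr.
  have c1 : 0 < c%:Z - 1 by rewrite mue in hE; nia.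
  apply: (proportional_coroots D_simply_connected D_reduced eD nuD c1 (ltr01)).
  by rewrite scale1r.
move=> [x xD [/and3P[rx wx wsx] xe]].
have k0 := reversed_pairing he rx; have /andP[hx sx] := rx.
exists x, (- (reflection D e *m x)), `|pairing (root D e) x|%N; split.
- exact/word_inversionP.
- apply/word_inversionP; split; first by rewrite coroot_opp // reflection_coroot.
    by rewrite htN oppr_gt0.
  by rewrite mulmxN htN oppr_lt0.
- rewrite reflectionE opprB => E; apply: xe.
  have two : (0 : int) < 2 by [].
  apply: (proportional_coroots D_simply_connected D_reduced xD eD two k0).
  by rewrite (scaler_nat 2) mulr2n {2}E addrC subrK.
- by rewrite absz_gt0 gt_eqF.
- by rewrite reflectionE opprB addrC subrK -scaler_nat natz gez0_abs ?ltW.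
Qed.

(** The point is that [s_e alpha_j] cannot be negative when [w s_e alpha_j] is:
    if it were, [<e, alpha_j>] would be positive, and [w e < 0 < w alpha_j]
    would make [w s_e alpha_j = w alpha_j - <e, alpha_j> w e] positive. *)
Lemma min_reps_reflection J t e : inversions D alpha (W t) e ->
  min_reps D alpha J (W t) ->
  (forall j, j \in J -> 0 < ht (W t *m reflection D e *m alpha j)) <->
  (forall j, j \in J ->
    ~ inversions D alpha (W t) (reflection D e *m alpha j)).
Proof.
move=> /word_inversionP[eD he we] /min_repsP wJ.
split=> H j jJ; have := H j jJ; have aD := simple_coroot j.
  by rewrite -mulmxA => h /word_inversionP[]; lia.
have sD := reflection_coroot eD aD.
have := ht_neq0 (word_prod_coroot t sD); rewrite -mulmxA.
case: (ltgtP (ht _) 0) => // wsa _ ninv; case: ninv.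
apply/word_inversionP; split=> //.
have := wJ j jJ; move: wsa; rewrite ht_reflection => wsa wa.
have := ht_reflection 1%:M e (alpha j); rewrite !mul1mx => ->.
have := ht_simple j; nia.
Qed.

End Base.

Theorem proposition3p7 (n : nat) (D : rootDatum n)
    (D_reduced : reduced D) (D_irreducible : irreducible D)
    (D_simply_connected : simply_connected D)
    (I : finType) (alpha : I -> 'cV[int]_n) (alpha_base : is_base D alpha)
    (I_P : {set I}) (w : 'M[int]_n) (w_min : min_reps D alpha I_P w) :
  covers D alpha w I_P =
  [set eta | [/\ inversions D alpha w eta,
      ~ decomposable (inversions D alpha w) eta
    & forall j : I, j \in I_P ->
        ~ inversions D alpha w (reflection D eta *m alpha j)]].
Proof.
have [t _ wt] : weyl D alpha w by case: w_min.
subst w; apply/seteqP; split=> eta /= [we].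
all: have [etaD heta weta] := (word_inversionP D_reduced alpha_base t eta).1 we.
all: have etap := (pos_corootP D_reduced alpha_base etaD).2 heta.
all: have [t' _ Et'] := strong_exchange D_reduced alpha_base etap weta.
all: have cov := length_cover D_reduced alpha_base we.
all: have dec := decomposable_mirrored D_reduced alpha_base D_simply_connected we.
all: have min := min_reps_reflection D_reduced alpha_base we w_min.
all: have repP := min_repsP D_reduced alpha_base I_P t'.
all: rewrite -Et' in repP.
- rewrite Et' !length_word // -Et' => /cov only rep; split=> //.
    by move/dec => [x xD [lx]]; apply; apply: only.
  by apply/min/repP.
- move=> ind noinv; split=> //; last by apply/repP/min.
  rewrite Et' !length_word // -Et'; apply/cov => x xD lx.
  by apply: contrapT => xe; apply/ind/dec; exists x.
Qed.
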